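(* Let $n\ge2$ and $m\ge3$ be integers. The following are equivalent for maps $\phi_i:\langle\mathbf{RS}_n\rangle\to\langle\mathbf{RS}_n\rangle$ ($i=1,\ldots,m$): (1) $\operatorname{tr}(\phi_1(A_1)\phi_2(A_2)\cdots\phi_m(A_m))=\operatorname{tr}(A_1A_2\cdots A_m)$ for all $A_1,\ldots,A_m\in\langle\mathbf{RS}_n\rangle$. (2) $\operatorname{spec}(\phi_1(A_1)\phi_2(A_2)\cdots\phi_m(A_m))=\operatorname{spec}(A_1A_2\cdots A_m)$ for all $A_1,\ldots,A_m\in\langle\mathbf{RS}_n\rangle$. (3) When $n=2$, there exist $P\in\left\{I_2,\begin{pmatrix}1&0\\0&-1\end{pmatrix}\right\}$ and invertible matrices $Q_1,Q_2,\ldots,Q_m\in\langle\mathbf{DS}_2\rangle$ with $Q_1Q_2\cdots Q_m=I_2$ such that $$\phi_i(A)_{\mathbf{DS}}=PA_{\mathbf{DS}}P^{-1}Q_i\qquad\text{for all }A\in\langle\mathbf{RS}_2\rangle,\ i\in\{1,\ldots,m\}.$$ When $n\ge3$, there exist invertible matrices $P_1,P_2,\ldots,P_m,P_{m+1}\in\langle\mathbf{DS}_n\rangle$ with $P_{m+1}=P_1$ such that $$\phi_i(A)_{\mathbf{DS}}=P_iA_{\mathbf{DS}}P_{i+1}^{-1}\qquad\text{for all }A\in\langle\mathbf{RS}_n\rangle,\ i\in\{1,\ldots,m\}.$$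
   Context: $\mathbf{DS}_n$ (resp. $\mathbf{RS}_n$) is the set of $n\times n$ doubly stochastic (resp. row stochastic) matrices: real, entrywise nonnegative, with all row sums and column sums (resp. all row sums) equal to $1$. $\langle\cdot\rangle$ denotes the real linear span. Let $e=(1,\ldots,1)^t\in\mathbb{R}^n$ and $R_n=\{ev^t: v\in\mathbb{R}^n,\ v^te=0\}$. One has the vector space direct sum $\langle\mathbf{RS}_n\rangle=\langle\mathbf{DS}_n\rangle\oplus R_n$, and for $A\in\langle\mathbf{RS}_n\rangle$ we write $A=A_{\mathbf{DS}}+A_R$ with $A_{\mathbf{DS}}\in\langle\mathbf{DS}_n\rangle$ and $A_R\in R_n$; explicitly, $A_R=er^t$ where $r_i=\frac1n\sum_{k}a_{ki}-\frac1{n^2}\sum_{k,l}a_{kl}$ and $A_{\mathbf{DS}}=A-A_R$. $\operatorname{spec}(A)$ is the spectrum (multiset of complex eigenvalues) counting multiplicities. The maps are not assumed linear. *)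

(* Defs.v *)
From mathcomp Require Import all_boot all_order all_algebra.
From mathcomp Require Import finmap multiset complex.
From mathcomp Require Import reals ring lra.

Set Implicit Arguments.
Unset Strict Implicit.
Unset Printing Implicit Defensive.

Import Order.TTheory GRing.Theory Num.Theory.

Local Open Scope ring_scope.
Local Open Scope complex_scope.

(* [linspan S] is the linear span of a possibly infinite set [S]; the library *)
(* [<<s>>%VS] is the span of a finite sequence.                               *)
Definition linspan (K : fieldType) (V : vectType K) (S : V -> Prop) (x : V) :
    Prop :=
  exists2 s : seq V, (forall y, y \in s -> S y) & x \in <<s>>%VS.

Definition row_stochastic (R : realType) (n : nat) (A : 'M[R]_n) : Prop :=
  (forall i j, 0 <= A i j) /\ (forall i, \sum_j A i j = 1).

Definition doubly_stochastic (R : realType) (n : nat) (A : 'M[R]_n) : Prop :=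
  row_stochastic A /\ (forall j, \sum_i A i j = 1).

Definition RSspan (R : realType) (n : nat) : 'M[R]_n -> Prop :=
  linspan (@row_stochastic R n).

Definition DSspan (R : realType) (n : nat) : 'M[R]_n -> Prop :=
  linspan (@doubly_stochastic R n).

Definition ones (R : realType) (n : nat) : 'cV[R]_n := const_mx 1.

Definition Rspace (R : realType) (n : nat) (A : 'M[R]_n) : Prop :=
  exists2 v : 'cV[R]_n, v^T *m ones R n = 0 & A = ones R n *m v^T.

(* [A_R A] and [A_DS A] are given by closed formulas; for [A] in the span of  *)
(* the row stochastic matrices, [A_DS_A_R_decomp] and [A_DS_A_R_unique] below *)
(* show that they are its components in the direct sum of [DSspan] and        *)
(* [Rspace].                                                                  *)
Definition A_R (R : realType) (n : nat) (A : 'M[R]_n) : 'M[R]_n :=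
  ones R n *m (\col_i ((\sum_k A k i) / n%:R
                       - (\sum_k \sum_l A k l) / n%:R ^+ 2))^T.

Definition A_DS (R : realType) (n : nat) (A : 'M[R]_n) : 'M[R]_n := A - A_R A.

(* The multiset of complex eigenvalues of a real matrix, that is, the roots   *)
(* of its characteristic polynomial over [R[i]] with algebraic multiplicities *)
Definition spec (R : realType) (n : nat) (A : 'M[R]_n) : {mset R[i]}%mset :=
  seq_mset (sval (closed_field_poly_normal
                    (char_poly (map_mx (real_complex R) A)))).

(* Ordered product [A 0 *m A 1 *m ... *m A (m - 1)] *)
Definition mxprod (R : realType) (m n : nat) (A : 'I_m -> 'M[R]_n) : 'M[R]_n :=
  \big[mulmx/1%:M]_(i < m) A i.

(* For [n = 2] this is the diagonal matrix with diagonal (1, -1). *)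
Definition altsign_mx (R : realType) (n : nat) : 'M[R]_n :=
  diag_mx (\row_(i < n) (-1) ^+ i).

Lemma linspan_ind (K : fieldType) (V : vectType K) (S P : V -> Prop) :
  P 0 -> (forall a x y, P x -> P y -> P (a *: x + y)) ->
  (forall x, S x -> P x) -> forall x, linspan S x -> P x.
Proof.
move=> P0 Pl SP x [s sS xs].
rewrite (coord_span (X := in_tuple s) xs).
apply: (big_ind P) => // [y z Py Pz|i _]; first by rewrite -[y]scale1r; apply: Pl.
rewrite -[_ *: _]addr0; apply: Pl => //.
by apply/SP/sS/mem_nth.
Qed.

Lemma linspan_lin (K : fieldType) (V : vectType K) (S : V -> Prop) (a : K)
    (x y : V) :
  linspan S x -> linspan S y -> linspan S (a *: x + y).
Proof.
move=> [s sS xs] [t tS yt]; exists (s ++ t).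
  by move=> z; rewrite mem_cat => /orP[/sS|/tS].
by rewrite span_cat memv_add // memvZ.
Qed.

Lemma linspan_gen (K : fieldType) (V : vectType K) (S : V -> Prop) (x : V) :
  S x -> linspan S x.
Proof.
move=> Sx; exists [:: x]; first by move=> y; rewrite inE => /eqP ->.
by rewrite memv_span // inE.
Qed.

Lemma linspan0 (K : fieldType) (V : vectType K) (S : V -> Prop) : linspan S 0.
Proof. by exists [::] => //; exact: mem0v. Qed.

Lemma RSspan_rowsum (R : realType) (n : nat) (A : 'M[R]_n) :
  RSspan A -> exists s, forall i, \sum_j A i j = s.
Proof.
move: A; apply: linspan_ind.
- by exists 0 => i; rewrite big1 // => j _; rewrite mxE.
- move=> a A B [s sA] [t tB]; exists (a * s + t) => i.
  rewrite -(sA i) -(tB i) mulr_sumr -big_split /=.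
  by apply: eq_bigr => j _; rewrite !mxE.
- by move=> A [_ A1]; exists 1.
Qed.

Lemma DSspan_sums (R : realType) (n : nat) (A : 'M[R]_n) :
  DSspan A ->
  exists s, (forall i, \sum_j A i j = s) /\ (forall j, \sum_i A i j = s).
Proof.
move: A; apply: linspan_ind.
- by exists 0; split=> i; rewrite big1 // => j _; rewrite mxE.
- move=> a A B [s [rA cA]] [t [rB cB]]; exists (a * s + t).
  split=> i.
    rewrite -(rA i) -(rB i) mulr_sumr -big_split /=.
    by apply: eq_bigr => j _; rewrite !mxE.
  rewrite -(cA i) -(cB i) mulr_sumr -big_split /=.
  by apply: eq_bigr => j _; rewrite !mxE.
- by move=> A [[_ rA] cA]; exists 1.
Qed.

Lemma sums_DSspan (R : realType) (n : nat) (A : 'M[R]_n) (s : R) :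
  (0 < n)%N -> (forall i, \sum_j A i j = s) -> (forall j, \sum_i A i j = s) ->
  DSspan A.
Proof.
move=> n0 rA cA.
have n0R : 0 < n%:R :> R by rewrite ltr0n.
pose t := \sum_i \sum_j `|A i j| + `|s| + 1.
have At i j : `|A i j| <= t.
  rewrite /t (bigD1 i) //= (bigD1 j) //=.
  have h1 : 0 <= \sum_(k | k != i) \sum_l `|A k l|.
    by apply: sumr_ge0 => k _; apply: sumr_ge0.
  have h2 : 0 <= \sum_(l | l != j) `|A i l| by apply: sumr_ge0.
  have := normr_ge0 s; lra.
have st : `|s| + 1 <= t.
  by rewrite /t -addrA lerDr; apply: sumr_ge0 => k _; apply: sumr_ge0.
have t0 : 0 < t by have := normr_ge0 s; lra.
pose c := s + t * n%:R.
have c0 : 0 < c.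
  have : t <= t * n%:R by rewrite ler_peMr ?(ltW t0) ?ler1n.
  have := lerNnormlW (lexx `|s|); rewrite /c; lra.
have cn : c != 0 by rewrite gt_eqF.
have sumt : \sum_(j < n) t = t * n%:R by rewrite sumr_const card_ord mulr_natr.
have D1 : doubly_stochastic (c^-1 *: (A + const_mx t)).
  split; first split=> i.
  - move=> j; rewrite !mxE mulr_ge0 ?invr_ge0 ?(ltW c0) //.
    have := lerNnormlW (At i j); lra.
  - under eq_bigr do rewrite !mxE.
    by rewrite -mulr_sumr big_split /= rA sumt mulVf.
  - move=> j; under eq_bigr do rewrite !mxE.
    by rewrite -mulr_sumr big_split /= cA sumt mulVf.
have DJ : doubly_stochastic (const_mx n%:R^-1 : 'M[R]_n).
  have J1 : \sum_(j < n) n%:R^-1 = 1 :> R.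
    by rewrite sumr_const card_ord -[RHS](@mulVf _ n%:R) ?gt_eqF // mulr_natr.
  split; first split=> i.
  - by move=> j; rewrite mxE invr_ge0 ler0n.
  - by under eq_bigr do rewrite mxE.
  - by move=> j; under eq_bigr do rewrite mxE.
have -> : A = c *: (c^-1 *: (A + const_mx t)) +
              ((- t * n%:R) *: const_mx n%:R^-1 + 0).
  apply/matrixP=> i j; rewrite !mxE mulrA divff // mul1r addr0.
  by rewrite mulfK ?gt_eqF // addrK.
apply: linspan_lin; first exact: linspan_gen.
by apply: linspan_lin; [exact: linspan_gen | exact: linspan0].
Qed.

Lemma A_RE (R : realType) (n : nat) (A : 'M[R]_n) i j :
  A_R A i j = (\sum_k A k j) / n%:R - (\sum_k \sum_l A k l) / n%:R ^+ 2.
Proof. by rewrite mxE big_ord1 !mxE mul1r. Qed.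

Lemma A_DSE (R : realType) (n : nat) (A : 'M[R]_n) i j :
  A_DS A i j = A i j - ((\sum_k A k j) / n%:R
                        - (\sum_k \sum_l A k l) / n%:R ^+ 2).
Proof. by rewrite -(A_RE A i j) [LHS]mxE; congr (_ + _); rewrite mxE. Qed.

Lemma A_DS_A_R_decomp (R : realType) (n : nat) (A : 'M[R]_n) :
  (0 < n)%N -> RSspan A -> [/\ A = A_DS A + A_R A, DSspan (A_DS A) &
                              Rspace (A_R A)].
Proof.
move=> n0 /RSspan_rowsum[s sA].
have nn : n%:R != 0 :> R by rewrite pnatr_eq0 -lt0n.
have sumc (x : R) : \sum_(j < n) x = x * n%:R.
  by rewrite sumr_const card_ord mulr_natr.
have tot : \sum_k \sum_l A k l = s * n%:R.
  by under eq_bigr do rewrite sA; rewrite sumc.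
have row0 : \sum_j ((\sum_k A k j) / n%:R
              - (\sum_k \sum_l A k l) / n%:R ^+ 2) = 0.
  rewrite sumrB -mulr_suml exchange_big /= tot sumc.
  by field.
split; first by rewrite subrK.
- apply: (sums_DSspan (s := s)) => // i.
    under eq_bigr do rewrite A_DSE.
    by rewrite sumrB row0 sA subr0.
  under eq_bigr do rewrite A_DSE.
  by rewrite sumrB sumc tot; field.
- eexists; last reflexivity.
  apply/matrixP=> i j; rewrite !mxE -[RHS]row0.
  by apply: eq_bigr => k _; rewrite !mxE mulr1.
Qed.

Lemma A_DS_A_R_unique (R : realType) (n : nat) (A B C : 'M[R]_n) :
  (0 < n)%N -> A = B + C -> DSspan B -> Rspace C -> B = A_DS A /\ C = A_R A.
Proof.
move=> n0 -> /DSspan_sums[s [rB cB]] [v v0 ->].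
have nn : n%:R != 0 :> R by rewrite pnatr_eq0 -lt0n.
have sumc (x : R) : \sum_(j < n) x = x * n%:R.
  by rewrite sumr_const card_ord mulr_natr.
have CE i j : (ones R n *m v^T) i j = v j 0.
  by rewrite mxE big_ord1 !mxE mul1r.
have v1 : \sum_j v j 0 = 0.
  have := congr1 (fun M : 'M_1 => M 0 0) v0; rewrite !mxE => vv; rewrite -[RHS]vv.
  by apply: eq_bigr => j _; rewrite !mxE mulr1.
have CR : ones R n *m v^T = A_R (B + ones R n *m v^T).
  apply/matrixP=> i j; rewrite A_RE CE.
  under eq_bigr do rewrite mxE CE.
  under [X in _ - X / _]eq_bigr => k _.
    under eq_bigr do rewrite mxE CE.
    rewrite big_split /= rB v1 addr0.
    over.
  by rewrite big_split /= cB !sumc; field.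
split; last exact: CR.
by rewrite /A_DS -CR addrK.
Qed.

Lemma altsign_mx2 (R : realType) :
  altsign_mx R 2 = \matrix_(i, j) (if i == j then if i == 0 then 1 else -1 else 0).
Proof.
apply/matrixP=> i j; rewrite !mxE.
by case: i j => [[|[|[]]] //= ?] [[|[|[]]] //= ?]; rewrite ?expr0 ?expr1.
Qed.

Lemma char_poly_spec (R : realType) (n : nat) (A : 'M[R]_n) :
  char_poly (map_mx (real_complex R) A) = \prod_(z <- spec A) ('X - z%:P).
Proof.
rewrite (perm_big _ (perm_eq_seq_mset _)) /=.
case: closed_field_poly_normal => s /= {1}->.
by rewrite (monicP (char_poly_monic _)) scale1r.
Qed.

(* Main.v *)
From HB Require Import structures.
Require Import Defs.
From mathcomp Require Import all_boot all_order all_algebra falgebra.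
From mathcomp Require Import reals complex.

Set Implicit Arguments.
Unset Strict Implicit.
Unset Printing Implicit Defensive.

Import Order.TTheory GRing.Theory Num.Theory.
Local Open Scope ring_scope.

(** Why the theorem holds.  Conjugation by a basis made of [e] and of a basis of
the vectors with zero coordinate sum turns a matrix with constant row sums [s]
into a block triangular matrix with diagonal blocks [s] and [M], and turns the
span of the doubly stochastic matrices into the block diagonal matrices.  So
that span is a copy of the algebra [B = R * M_(n-1)(R)], and
[A |-> A_DS = (s, M)] is an algebra morphism on the span of the row stochastic
matrices which keeps the characteristic polynomial ([parts_prod],
[char_poly_parts], [A_DS_parts]).  The part [A_R] is thus invisible to traces and
spectra, and the statement becomes one about the algebra [B] with the trace form
[ptrace (s, M) = s + tr M], which is nondegenerate.

Let [tau] be a nondegenerate trace form on a finite-dimensional algebra, and let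
[f_1, ..., f_m] satisfy [tau (f_1 x_1 * ... * f_m x_m) = tau (x_1 * ... * x_m)].
Setting all but two of the arguments to [1] shows that the values of each map
span the algebra, so identities between products of the [f_i] can be tested
under [tau]; this makes the [f_i] linear and bijective without assuming either.
Because [m >= 3], two neighbours can be tested against a third map, which gives
[f_i x * f_(i+1) y = f_i (x * y) * f_(i+1) 1].  Hence all [f_i 1] are units and
[alpha x = f_1 x / f_1 1] is an algebra automorphism; with
[u_i = f_1 1 * ... * f_(i-1) 1] one gets [f_i x = u_i^-1 * alpha x * u_(i+1)]
([tau_preserving_structure]).

It remains to know the automorphisms of [R * M_k(R)].  For [k >= 2] there is no
nonzero multiplicative linear functional on [M_k(R)], because the nilpotent
matrix units generate it; this forces [alpha] to respect the two factors, and
Skolem-Noether makes it inner ([lrmorphism_pair_inner]).  For [k = 1] there is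
besides the identity the exchange of the two factors ([lrmorphism_pair_swap]),
which on 2 x 2 matrices is conjugation by [diag(1, -1)] ([altsign_conj]).  Both
kinds preserve [ptrace], hence [u_(m+1) = 1], and the formulas of the third
condition follow with [P_i = u_i^-1 * p], respectively [Q_i = u_i^-1 * u_(i+1)].

Conversely such formulas make the product of the [phi_i(A_i)_DS] a conjugate of
the product of the [(A_i)_DS], so that the spectra agree; and the spectrum
determines the trace. *)

(** * Maps that preserve the trace of products *)
Section TracePreservers.

Variables (K : fieldType) (B : falgType K) (tau : {scalar B}).
Hypothesis tauC : forall x y : B, tau (x * y) = tau (y * x).
Hypothesis tau_nondegenerate : forall x : B, (forall y, tau (x * y) = 0) -> x = 0.

(** The maps to be studied live on row stochastic matrices and are compared with
their image in the quotient algebra [B]; hence an arbitrary domain [X] with a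
split surjection [rho] onto [B]. *)
Variables (X : Type) (rho : X -> B) (sigma : B -> X).
Hypothesis sigmaK : cancel sigma rho.

Definition paired (p b : X -> B) :=
  forall x y, tau (p x * b y) = tau (rho x * rho y).

(** The values of [b] span [B]: a linear dependence between the values of [b] on a
basis, tested against all values of [p], is one between the basis vectors, since
[tau] is nondegenerate. *)
Lemma paired_detect p b w :
  paired p b -> (forall y, tau (w * b y) = 0) -> w = 0.
Proof.
move=> pb wb0; apply: tau_nondegenerate => v.
pose e := vbasis (fullv : {vspace B}).
pose be := map_tuple (b \o sigma) e.
have be_i (i : 'I_(\dim (fullv : {vspace B}))) : be`_i = b (sigma e`_i).
  by rewrite (nth_map 0) // size_tuple ltn_ord.
have be_free : free be.
  apply/freeP => c c0 i.
  have ce0 : \sum_(j < \dim (fullv : {vspace B})) c j *: e`_j = 0.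
    apply: tau_nondegenerate => y; rewrite tauC.
    transitivity (tau (p (sigma y) * \sum_j c j *: be`_j)); last first.
      by rewrite c0 mulr0 linear0.
    rewrite !mulr_sumr !linear_sum; apply: eq_bigr => j _.
    by rewrite -!scalerAr !linearZ be_i pb !sigmaK.
  by have /freeP/(_ c ce0) := basis_free (vbasisP (fullv : {vspace B})).
have be_basis : basis_of fullv be.
  by rewrite basisEfree be_free subvf size_tuple /=.
rewrite (coord_basis be_basis (memvf v)) mulr_sumr linear_sum big1 // => j _.
by rewrite -scalerAr linearZ be_i wb0 /= mulr0.
Qed.

(** Linearity is not assumed but comes from that of [tau], as the two sides can be
compared after pairing with the values of [b]. *)
Lemma paired_linear p b a x y z : paired p b ->
  rho z = a *: rho x + rho y -> p z = a *: p x + p y.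
Proof.
move=> pb zE; apply/eqP; rewrite -subr_eq0; apply/eqP.
apply: (paired_detect pb) => t.
rewrite mulrBl mulrDl -scalerAl linearB linearD linearZ /= !pb zE.
by rewrite mulrDl -scalerAl linearD linearZ subrr.
Qed.

Lemma paired_factor p b x y : paired p b -> rho x = rho y -> p x = p y.
Proof.
move=> pb xy; apply/eqP; rewrite -subr_eq0; apply/eqP.
by apply: (paired_detect pb) => t; rewrite mulrBl linearB /= !pb xy subrr.
Qed.

Lemma paired_surj p b v : paired p b -> exists x, p x = v.
Proof.
move=> pb; pose g u := p (sigma u).
have g_lin : linear g.
  by move=> a x y; apply: (paired_linear pb); rewrite !sigmaK.
pose gL : {linear B -> B} :=
  HB.pack g (GRing.isLinear.Build K B B *:%R g g_lin).
have gker : lker (linfun gL) == 0%VS.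
  apply/lker0P => x y; rewrite !lfunE /= => xy.
  apply/eqP; rewrite -subr_eq0; apply/eqP/tau_nondegenerate => t.
  rewrite mulrBl linearB /= -[in tau (x * t)](sigmaK x).
  rewrite -[in tau (y * t)](sigmaK y) -(sigmaK t) -!pb.
  by rewrite -/(g x) -/(g y) xy subrr.
exists (sigma ((linfun gL)^-1%VF v)).
by have := lker0_lfunVK gker v; rewrite lfunE.
Qed.

(** A family of [m >= 3] maps is studied through two neighbours [f], [g] and the
product [h] of all the others in cyclic order. *)
Definition tripled (f g h : X -> B) := forall x y z,
  tau (f x * g y * h z) = tau (rho x * rho y * rho z).

Lemma tripled_rot f g h : tripled f g h -> tripled g h f.
Proof. by move=> fgh x y z; rewrite tauC mulrA fgh tauC mulrA tauC mulrA. Qed.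

Let x1 := sigma 1.
Let rho_x1 : rho x1 = 1. Proof. exact: sigmaK. Qed.

Lemma tripled_pairl f g h : tripled f g h -> paired (fun x => f x * g x1) h.
Proof. by move=> fgh x z; rewrite fgh rho_x1 mulr1. Qed.

Lemma tripled_pairr f g h : tripled f g h -> paired f (fun y => g y * h x1).
Proof. by move=> fgh x y; rewrite mulrA fgh rho_x1 mulr1. Qed.

(** A right inverse of [f 1] is found among the values of [g], and a left inverse
among those of [h], by surjectivity of the two paired maps. *)
Lemma tripled_unit f g h : tripled f g h -> f x1 \is a GRing.unit.
Proof.
move=> fgh.
have right_pair : paired (fun y => f x1 * g y) h.
  by move=> y z; rewrite fgh rho_x1 mul1r.
have left_pair : paired (fun z => h z * f x1) g.
  by move=> z y; rewrite (tripled_rot (tripled_rot fgh)) rho_x1 mulr1.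
have [y fy] := paired_surj 1 right_pair.
have [z zf] := paired_surj 1 left_pair.
apply/unitrP; exists (g y); split => //.
suff -> : g y = h z by [].
by rewrite -[g y]mul1r -zf -mulrA fy mulr1.
Qed.

(** Here a third map is essential: both sides are tested against the values of [h],
where the invariance sees only the product [rho x * rho y]. *)
Lemma tripled_mul f g h x y z : tripled f g h ->
  rho z = rho x * rho y -> f x * g y = f z * g x1.
Proof.
move=> fgh zE; apply/eqP; rewrite -subr_eq0; apply/eqP.
apply: (paired_detect (tripled_pairl fgh)) => t.
by rewrite mulrBl linearB /= !fgh zE rho_x1 mulr1 subrr.
Qed.

(** In other words, [f x / f 1] depends multiplicatively on [x]. *)
Lemma tripled_mul1 f g h x y z : tripled f g h ->
  rho z = rho x * rho y -> f z = f x / f x1 * f y.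
Proof.
move=> fgh zE.
have gu : g x1 \is a GRing.unit := tripled_unit (tripled_rot fgh).
apply: (mulIr gu); rewrite -(tripled_mul fgh zE) -[RHS]mulrA.
have <- : f x1 * g y = f y * g x1.
  by apply: (tripled_mul fgh); rewrite rho_x1 mul1r.
by rewrite mulrA divrK // (tripled_unit fgh).
Qed.

Definition tau_preserving m (f : 'I_m -> X -> B) := forall x : 'I_m -> X,
  tau (\prod_(i < m) f i (x i)) = tau (\prod_(i < m) rho (x i)).

(** Cyclic invariance of the trace; it lets every statement about neighbouring
positions be proved at the first two. *)
Lemma tau_prod_ordS m (F : 'I_m -> B) :
  tau (\prod_(i < m) F (ordS i)) = tau (\prod_(i < m) F i).
Proof.
case: m F => [|m] F; first by rewrite !big_ord0.
rewrite big_ord_recr big_ord_recl /= tauC.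
congr (tau (F _ * _)); first by apply: val_inj; rewrite /= modnn.
apply: eq_bigr => i _; congr F; apply: val_inj => /=.
by rewrite modn_small // ltnS.
Qed.

Lemma tau_preserving_ordS m (f : 'I_m -> X -> B) :
  tau_preserving f -> tau_preserving (fun i => f (ordS i)).
Proof.
move=> pf x; pose x' i := x (ord_pred i).
transitivity (tau (\prod_(i < m) f i (x' i))).
  rewrite -[RHS]tau_prod_ordS; congr (tau _); apply: eq_bigr => i _.
  by rewrite /x' ordSK.
rewrite pf -tau_prod_ordS; congr (tau _); apply: eq_bigr => i _.
by rewrite /x' ordSK.
Qed.

Lemma tau_preserving_tripled m (f : 'I_m -> X -> B) (i : 'I_m) :
  (2 < m)%N -> tau_preserving f -> exists h, tripled (f i) (f (ordS i)) h.
Proof.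
case: m f i => [|[|[|m]]] // f i _.
have -> : i = iter i (@ordS m.+3) ord0.
  suff itE k : (k < m.+3)%N -> val (iter k (@ordS m.+3) ord0) = k.
    by apply: val_inj; rewrite itE.
  elim: k => [|k IHk] //= km; have := IHk (ltnW km) => /= ->.
  by rewrite modn_small.
elim: (i : nat) f => [|k IHk] f pf; last first.
  exact: IHk (tau_preserving_ordS pf).
pose j1 : 'I_m.+3 := lift ord0 ord0.
pose j2 : 'I_m.+3 := lift ord0 (lift ord0 ord0).
(* The arguments from position 3 on are frozen to [x1] and absorbed in [h]. *)
pose l (j : 'I_m) : 'I_m.+3 := lift ord0 (lift ord0 (lift ord0 j)).
exists (fun z => f j2 z * \prod_(j < m) f (l j) x1) => x y z /=.
have -> : ordS (ord0 : 'I_m.+3) = j1 by apply: val_inj.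
pose t (j : 'I_m.+3) := nth x1 [:: x; y; z] j.
transitivity (tau (\prod_j f j (t j))).
  rewrite 3!big_ord_recl !mulrA; congr (tau (_ * _ * _ * _)).
  by apply: eq_bigr => j _; rewrite /t /= nth_default.
rewrite pf 3!big_ord_recl !mulrA big1 ?mulr1 // => j _.
by rewrite /t /= nth_default.
Qed.

(** The partial products [u] of the values [f_i 1] measure how far the [f_i] are
from one common automorphism.  The last clause records what the invariance says
once this form is known; it yields [u m = 1] when [alpha] preserves [tau], which
can fail for an exchange of unequally weighted factors. *)
Theorem tau_preserving_structure m (f : 'I_m -> X -> B) :
  (2 < m)%N -> tau_preserving f ->
  exists (alpha : {lrmorphism B -> B}) (u : nat -> B),
    [/\ injective alpha, forall v, exists b, alpha b = v,
        u 0%N = 1 /\ forall k, u k \is a GRing.unit,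
        forall (i : 'I_m) x, f i x = (u i)^-1 * alpha (rho x) * u i.+1 &
        forall b, tau (alpha b * u m) = tau b].
Proof.
case: m f => [//|m] f m2 pf.
have trip i := tau_preserving_tripled i m2 pf.
have q_unit i : f i x1 \is a GRing.unit.
  by have [h /tripled_unit] := trip i.
have [h0 trip0] := trip ord0.
have pair0 := tripled_pairr trip0.
set q0 := f ord0 x1; have q0u : q0 \is a GRing.unit := q_unit ord0.
pose a b := f ord0 (sigma b) / q0.
have a_rho x : a (rho x) = f ord0 x / q0.
  by rewrite /a (paired_factor pair0 (sigmaK (rho x))).
have a_lin : linear a.
  move=> c x y; rewrite /a.
  rewrite (paired_linear (a := c) (x := sigma x) (y := sigma y) pair0) ?sigmaK //.
  by rewrite mulrDl -scalerAl.
have a_mul : monoid_morphism a.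
  split=> [|x y]; first by rewrite /a divrr.
  rewrite /a (tripled_mul1 (x := sigma x) (y := sigma y) trip0) ?sigmaK //.
  by rewrite !mulrA.
pose alpha : {lrmorphism B -> B} := HB.pack a
  (GRing.isLinear.Build K B B *:%R a a_lin)
  (GRing.isMonoidMorphism.Build B B a a_mul).
pose u k := \prod_(j < k) f (inord j) x1.
have uS k : u k.+1 = u k * f (inord k) x1 by rewrite /u big_ord_recr.
have u_unit k : u k \is a GRing.unit.
  by elim: k => [|k IHk]; rewrite ?uS /u ?big_ord0 ?unitr1 // unitrMl.
have fE k x : (k < m.+1)%N -> u k * f (inord k) x = alpha (rho x) * u k.+1.
  elim: k x => [|k IHk] x km.
    rewrite uS /u big_ord0 !mul1r /= a_rho.
    have -> : inord 0 = ord0 :> 'I_m.+1 by apply: val_inj; rewrite /= inordK.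
    by rewrite divrK.
  rewrite [u k.+2]uS mulrA -IHk 1?ltnW // -mulrA uS -mulrA; congr (_ * _).
  have [h tri] := trip (inord k).
  have -> : inord k.+1 = ordS (inord k) :> 'I_m.+1.
    by apply: val_inj; rewrite /= !inordK ?modn_small // ltnW.
  by apply: (tripled_mul tri); rewrite rho_x1 mul1r.
exists alpha, u; split.
- move=> b c /(mulIr _) bc; apply/eqP; rewrite -subr_eq0; apply/eqP.
  apply: tau_nondegenerate => y; rewrite mulrBl linearB /=.
  rewrite -(sigmaK b) -(sigmaK c) -(sigmaK y) -!pair0 bc ?subrr //.
  by rewrite unitrV.
- move=> v; have [x fx] := paired_surj (v * q0) pair0.
  by exists (rho x); rewrite /= a_rho fx mulrK.
- by split=> //; rewrite /u big_ord0.
- by move=> i x; rewrite -mulrA -fE ?ltn_ord // mulKr // inord_val.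
- move=> b; pose t (i : 'I_m.+1) := if i == ord_max then sigma b else x1.
  have neq (j : 'I_m) : (widen_ord (leqnSn m) j == ord_max) = false.
    by apply/negbTE; rewrite neq_ltn /= ltn_ord.
  transitivity (tau (\prod_i f i (t i))).
    rewrite -[in alpha b](sigmaK b) -fE // big_ord_recr /= /t eqxx.
    congr (tau (_ * f _ _)); last by apply: val_inj; rewrite /= inordK.
    apply: eq_bigr => j _; rewrite neq; congr (f _ _).
    by apply: val_inj; rewrite /= inordK // ltnW // ltnS.
  rewrite pf big_ord_recr /= /t eqxx sigmaK big1 ?mul1r // => j _.
  by rewrite neq.
Qed.

End TracePreservers.

(** * Automorphisms of a field times a matrix algebra *)
Lemma regular_scale1 (K : fieldType) (a : K^o) : a *: (1 : K^o) = a.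
Proof. exact: mulr1. Qed.

(** The images [F i j] of the matrix units are again matrix units.  If [v] is a
nonzero column of [F 0 0], then the vectors [F l 0 *m v] form a basis on which
[beta M] acts as [M] does on the standard basis; [P] has them as columns. *)
Lemma Skolem_Noether_mx (K : fieldType) k
    (beta : {lrmorphism 'M[K]_k.+1 -> 'M[K]_k.+1}) :
  exists2 P : 'M[K]_k.+1, P \is a GRing.unit & forall M, beta M = P * M / P.
Proof.
pose F i j := beta (delta_mx i j).
have FF i j l h : F i j *m F l h = F i h *+ (j == l).
  by rewrite /F -raddfMn -mul_delta_mx_cond; exact: esym (rmorphM beta _ _).
have [a [j Faj]] : exists a j, F 0 0 a j != 0.
  case: (pickP (fun ij : 'I_k.+1 * 'I_k.+1 => F 0 0 ij.1 ij.2 != 0)) => [[a j] Faj|F0].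
    by exists a, j.
  have {}F0 : F 0 0 = 0.
    by apply/matrixP=> a j; have /negbFE/eqP := F0 (a, j); rewrite mxE.
  have := oner_neq0 'M[K]_k.+1; rewrite -(rmorph1 beta) -idmxE mx1_sum_delta.
  rewrite (raddf_sum beta) big1 ?eqxx // => i _; change (F i i = 0).
  have := FF i 0 0 i; rewrite eqxx mulr1n => <-.
  by have := FF i 0 0 0; rewrite eqxx mulr1n F0 mulmx0 => <-; rewrite mul0mx.
(* Since [F l 0 *m F 0 0 = F l 0], column [l] of [P] is column [j] of [F l 0]; the
   rows of [Q] are the dual basis, normalised by a nonzero entry of [F 0 0]. *)
pose P := \matrix_(i, l) F l 0 i j.
pose Q := \matrix_(l, b) ((F 0 0 a j)^-1 * F 0 l a b).
have QP : Q *m P = 1%:M.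
  apply/matrixP=> l h; rewrite !mxE.
  transitivity ((F 0 0 a j)^-1 * (F 0 l *m F h 0) a j).
    by rewrite !mxE mulr_sumr; apply: eq_bigr => b _; rewrite !mxE mulrA.
  by rewrite FF; case: eqP => _; rewrite ?mulr1n ?mulr0n ?mulVf // mxE mulr0.
have Pu : P \is a GRing.unit by have [] := mulmx1_unit QP.
exists P => // M; apply: (mulIr Pu); rewrite divrK //.
apply/matrixP=> i l.
transitivity ((beta M *m F l 0) i j).
  by rewrite !mxE; apply: eq_bigr => b _; rewrite !mxE.
have MEl : M * delta_mx l 0 = \sum_b M b l *: delta_mx b 0.
  apply/matrixP=> b c; rewrite summxE -mulmxE mxE (bigD1 l) //= !mxE eqxx /=.
  rewrite big1 ?addr0 => [|d dl]; last by rewrite !mxE (negbTE dl) mulr0.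
  rewrite (bigD1 b) //= !mxE eqxx /= big1 ?addr0 // => d db.
  by rewrite !mxE eq_sym (negbTE db) mulr0.
rewrite mulmxE -rmorphM MEl raddf_sum summxE !mxE.
by apply: eq_bigr => b _; rewrite /= linearZ !mxE mulrC.
Qed.

Section AutomorphismsOfFieldTimesMatrices.

Variables (K : fieldType) (k : nat).
Notation B := (K^o * 'M[K]_k.+1)%type.
Variable alpha : {lrmorphism B -> B}.

Let pair_split (b : B) : b = b.1 *: ((1, 0) : B) + ((0, b.2) : B).
Proof.
case: b => s M; congr pair => /=; first by rewrite addr0 regular_scale1.
by rewrite scaler0 add0r.
Qed.

(** The first component [chi] of [alpha] on the matrix factor is a multiplicative
functional.  It kills the matrix units off the diagonal, which have square zero,
and so those on the diagonal, which are products of two of the former: this is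
where size at least 2 enters.  Then [alpha] induces the identity on the field and
an endomorphism [beta] of the matrix algebra. *)
Lemma lrmorphism_pair_inner : (0 < k)%N -> (forall v, exists b, alpha b = v) ->
  exists2 p : B, p \is a GRing.unit & forall b, alpha b = p * b / p.
Proof.
move=> k0 alpha_surj.
have inrM (M N : 'M[K]_k.+1) : ((0, M * N) : B) = (0, M) * (0, N).
  by congr pair; rewrite mulr0.
have inrL a (M N : 'M[K]_k.+1) : ((0, a *: M + N) : B) = a *: ((0, M) : B) + (0, N).
  by congr pair; rewrite /= scaler0 addr0.
pose chi M := (alpha (0, M)).1.
have chiM M N : chi (M * N) = chi M * chi N by rewrite /chi inrM rmorphM.
have chiL a M N : chi (a *: M + N) = a * chi M + chi N.
  by rewrite /chi inrL linearP.
have chi0 : chi 0 = 0 by rewrite /chi (_ : (0, 0) = 0 :> B) // rmorph0.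
have chi_offdiag i j : i != j -> chi (delta_mx i j) = 0.
  move=> ij; have : chi (delta_mx i j) * chi (delta_mx i j) = 0.
    by rewrite -chiM -mulmxE mul_delta_mx_0 // eq_sym.
  by move/eqP; rewrite mulf_eq0 orbb => /eqP.
have chi_delta i j : chi (delta_mx i j) = 0.
  have [-> | /chi_offdiag//] := eqVneq i j.
  have [h jh] : exists h, j != h.
    by exists (if j == ord0 then ord_max else ord0); case: (eqVneq j ord0) => [->|//];
      rewrite -val_eqE /= neq_ltn k0.
  by rewrite -(mul_delta_mx h) mulmxE chiM chi_offdiag ?mul0r.
have {}chi0 M : chi M = 0.
  rewrite [M]matrix_sum_delta.
  elim/big_rec: _ => // i N _ N0; elim/big_rec: _ => [|j N' _ N'0].
    by rewrite add0r.
  by rewrite -addrA chiL chi_delta mulr0 add0r.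
pose beta M := (alpha (0, M)).2.
pose eps : B := (1, 0); pose Z := (alpha eps).2.
have epsE : eps + (0, 1) = 1 by congr pair; rewrite /= ?addr0 ?add0r.
have eps1 : (alpha eps).1 = 1.
  have := congr1 (fun b : B => (alpha b).1) epsE; rewrite rmorph1 rmorphD /= => <-.
  by rewrite [X in _ = _ + X]chi0 addr0.
have Zbeta M : Z * beta M = 0.
  have -> : Z * beta M = (alpha (eps * (0, M))).2 by rewrite rmorphM.
  by rewrite (_ : _ * _ = 0) ?rmorph0 //; congr pair; rewrite ?mulr0 ?mul0r.
have alpha1 b : (alpha b).1 = b.1.
  rewrite [in LHS](pair_split b) linearP /= [X in _ + X]chi0 addr0 eps1.
  by rewrite regular_scale1.
(* The second component [Z] of the image of [eps = (1, 0)] annihilates the values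
   of [beta], and by surjectivity these contain 1. *)
have Z0 : Z = 0.
  have [b bE] := alpha_surj (0, 1).
  have b1 : b.1 = 0 by rewrite -alpha1 bE.
  have : beta b.2 = 1.
    by have := congr1 snd bE; rewrite [in X in X -> _](pair_split b) b1 scale0r add0r.
  by move=> b2; rewrite -[Z]mulr1 -b2 Zbeta.
have alphaE b : alpha b = (b.1, beta b.2).
  rewrite [LHS]surjective_pairing alpha1; congr pair.
  by rewrite [in LHS](pair_split b) linearP /= -/Z Z0 scaler0 add0r.
have beta_lin : linear beta by move=> a M N; rewrite /beta inrL linearP.
have beta_mul : monoid_morphism beta.
  split=> [|M N]; last by rewrite /beta inrM rmorphM.
  by have := congr1 snd (alphaE 1); rewrite rmorph1.
pose betaL : {lrmorphism 'M[K]_k.+1 -> 'M[K]_k.+1} := HB.pack beta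
  (GRing.isLinear.Build K _ _ *:%R beta beta_lin)
  (GRing.isMonoidMorphism.Build _ _ beta beta_mul).
have [P Pu PE] := Skolem_Noether_mx betaL.
have pu : ((1, P) : B) * (1, P^-1) = 1.
  by congr pair; rewrite /= ?mulr1 ?divrr.
exists (1, P).
  by apply/unitrP; exists (1, P^-1); split=> //; congr pair; rewrite /= ?mulr1 ?mulVr.
move=> b; have -> : (1, P)^-1 = (1, P^-1) :> B.
  rewrite -[LHS]mulr1 -pu mulKr //.
  by apply/unitrP; exists (1, P^-1); split=> //; congr pair; rewrite /= ?mulr1 ?mulVr.
rewrite alphaE (PE b.2 : beta _ = _); congr pair.
by rewrite /= mul1r mulr1.
Qed.

End AutomorphismsOfFieldTimesMatrices.

(** With two one-dimensional factors, [alpha] is determined by the image of the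
idempotent [(1, 0)].  Injectivity excludes the idempotents 0 and 1, so that it is
[(1, 0)] or [(0, 1)]. *)
Lemma lrmorphism_pair_swap (K : fieldType)
    (alpha : {lrmorphism (K^o * 'M[K]_1)%type -> (K^o * 'M[K]_1)%type}) :
  injective alpha ->
  (forall b, alpha b = b) \/ (forall b, alpha b = (b.2 0 0, b.1%:M)).
Proof.
move=> alpha_inj; set B := (K^o * 'M[K]_1)%type in alpha alpha_inj *.
pose eps : B := (1, 0).
have eps_idem : alpha eps * alpha eps = alpha eps.
  by rewrite -rmorphM; congr (alpha _); congr pair; rewrite ?mulr0 ?mulr1.
have alphaE b : alpha b = b.1 *: alpha eps + b.2 0 0 *: (1 - alpha eps).
  rewrite -[in RHS](rmorph1 alpha) -rmorphB -!linearZ -rmorphD; congr (alpha _).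
  case: b => s M /=; congr pair => /=.
    by rewrite subrr scaler0 addr0 regular_scale1.
  by rewrite subr0 scaler0 add0r [LHS]mx11_scalar -scalemx1.
have eps0 : alpha eps != 0.
  rewrite -(rmorph0 alpha) (inj_eq alpha_inj); apply/eqP => /(congr1 fst) /= /eqP.
  by rewrite oner_eq0.
have eps1 : alpha eps != 1.
  rewrite -(rmorph1 alpha) (inj_eq alpha_inj); apply/eqP => /(congr1 snd) /=.
  by move/esym/eqP; rewrite oner_eq0.
have idem01 (x : K) : x * x = x -> x = 0 \/ x = 1.
  move=> xx; have /eqP : x * (x - 1) = 0 by rewrite mulrBr xx mulr1 subrr.
  by rewrite mulf_eq0 subr_eq0 => /orP[] /eqP; [left|right].
move: (alpha eps) eps_idem alphaE eps0 eps1 => [x Y].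
rewrite [Y]mx11_scalar; move: (Y 0 0) => y.
move=> xy_idem alphaE.
have /idem01 x01 : x * x = x by have := congr1 fst xy_idem.
have /idem01 y01 : y * y = y.
  have := congr1 (fun b : B => b.2 0 0) xy_idem.
  by rewrite /= -mulmxE -scalar_mxM !mxE eqxx !mulr1n.
have mx0 : 0%:M = 0 :> 'M[K]_1 by rewrite raddf0.
case: x01 y01 alphaE => -> [] -> alphaE; rewrite ?mx0 ?eqxx // in alphaE * => _ _.
- right=> b; rewrite alphaE; congr pair => /=.
    by rewrite scaler0 add0r subr0 regular_scale1.
  by rewrite subrr scaler0 addr0 scalemx1.
- left=> b; rewrite alphaE; case: b => s M; congr pair => /=.
    by rewrite subrr scaler0 addr0 regular_scale1.
  by rewrite subr0 scaler0 add0r scalemx1 -mx11_scalar.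
Qed.

(** * Block coordinates for row stochastic matrices *)

(** Joins the structures of the product into that of a finite-dimensional algebra,
so that [R * M_k(R)] is an instance of the preceding theory. *)
HB.instance Definition _ (K : fieldType) (A B : falgType K) :=
  GRing.UnitRing.on (A * B)%type.

Lemma char_poly_conj (R : comNzRingType) n (A P Q : 'M[R]_n) :
  Q *m P = 1%:M -> char_poly (Q *m A *m P) = char_poly A.
Proof.
move=> QP; pose lift (M : 'M[R]_n) := map_mx polyC M.
have liftQP : lift Q *m lift P = 1%:M by rewrite -map_mxM QP map_mx1.
rewrite /char_poly.
have -> : char_poly_mx (Q *m A *m P) = lift Q *m char_poly_mx A *m lift P.
  rewrite /char_poly_mx mulmxBr mulmxBl !map_mxM; congr (_ - _).
  by rewrite scalar_mxC -mulmxA liftQP mulmx1.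
by rewrite !det_mulmx mulrAC -det_mulmx liftQP det1 mul1r.
Qed.

Section BlockCoordinates.

Variables (R : realType) (k : nat).
Notation n := (k.+2).
Notation mat := ('M[R]_(1 + k.+1)).
Notation B := (R^o * 'M[R]_k.+1)%type.

(** The columns of [frame] are [e], an eigenvector of every matrix with constant
row sums, and the differences of a standard basis vector with the first one,
which span the vectors of zero sum.  The matrix [coframe] is its inverse. *)
Definition frame : mat :=
  block_mx 1%:M (const_mx (-1)) (const_mx 1) 1%:M.

Definition coframe : mat :=
  block_mx n%:R^-1%:M (const_mx n%:R^-1)
           (const_mx (- n%:R^-1)) (1%:M - const_mx n%:R^-1).

Lemma mul_const_mx p q r (a b : R) :
  (const_mx a : 'M_(p, q)) *m (const_mx b : 'M_(q, r)) = const_mx (a * b *+ q).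
Proof.
apply/matrixP=> i j; rewrite !mxE.
under eq_bigr do rewrite !mxE.
by rewrite sumr_const card_ord.
Qed.

Lemma coframeK : coframe *m frame = 1%:M.
Proof.
have n0 : n%:R != 0 :> R by rewrite pnatr_eq0.
rewrite /coframe /frame mulmx_block !mulmx1 !mul_scalar_mx !mul_const_mx.
rewrite mulmxBl !mul1mx mul_const_mx !scalemx_const.
rewrite [RHS](@scalar_mx_block _ 1 k.+1).
congr block_mx; apply/matrixP=> i j; rewrite !mxE.
- by rewrite !ord1 eqxx !mulr1 !mulr1n -mulrS -(mulr_natr (n%:R^-1)) mulVf.
- by rewrite mulrN1 addNr.
- by rewrite !mulr1 addrCA -opprD -mulrS -(mulr_natr (n%:R^-1)) mulVf // subrr.
- by rewrite mulrN1 mulr1n opprK addrC subrK.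
Qed.

Lemma frameK : frame *m coframe = 1%:M.
Proof. exact: mulmx1C coframeK. Qed.

Definition coord (A : mat) : mat := coframe *m A *m frame.

Lemma coordM A C : coord (A *m C) = coord A *m coord C.
Proof.
by rewrite /coord !mulmxA -[coframe *m A *m frame *m coframe]mulmxA frameK mulmx1.
Qed.

Lemma coord1 : coord 1%:M = 1%:M.
Proof. by rewrite /coord mulmx1 coframeK. Qed.

Definition parts (A : mat) : B := (ulsubmx (coord A) 0 0, drsubmx (coord A)).

Definition from_parts (b : B) : mat :=
  frame *m block_mx (b.1%:M : 'M_1) 0 0 b.2 *m coframe.

Lemma coord_from_parts b : coord (from_parts b) = block_mx b.1%:M 0 0 b.2.
Proof.
rewrite /coord /from_parts !mulmxA coframeK mul1mx.
by rewrite -mulmxA coframeK mulmx1.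
Qed.

Lemma from_partsK : cancel from_parts parts.
Proof.
case=> s M; rewrite /parts coord_from_parts block_mxKul block_mxKdr.
by rewrite mxE eqxx.
Qed.

Lemma from_partsM b c : from_parts (b * c) = from_parts b * from_parts c.
Proof.
rewrite /from_parts -mulmxE !mulmxA; congr (_ *m _).
rewrite -[_ *m coframe *m frame]mulmxA coframeK mulmx1 -mulmxA; congr (_ *m _).
by rewrite mulmx_block !mulmx0 !mul0mx !addr0 add0r -scalar_mxM.
Qed.

Lemma from_parts1 : from_parts 1 = 1.
Proof. by rewrite /from_parts -scalar_mx_block mulmx1 frameK. Qed.

Lemma from_parts_prod m (b : 'I_m -> B) :
  from_parts (\prod_(i < m) b i) = \prod_(i < m) from_parts (b i).
Proof. exact: (big_morph _ from_partsM from_parts1). Qed.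

Lemma from_partsV b : b \is a GRing.unit ->
  from_parts b \in unitmx /\ invmx (from_parts b) = from_parts b^-1.
Proof.
move=> bu.
have bV : from_parts b *m from_parts b^-1 = 1%:M.
  by rewrite mulmxE -from_partsM divrr // from_parts1.
have [fu _] := mulmx1_unit bV; split=> //.
by rewrite -[LHS]mulmx1 -bV mulKmx.
Qed.

Lemma lsubmx_frame : lsubmx frame = ones R n.
Proof.
rewrite /frame block_mxEh row_mxKl (_ : 1%:M = const_mx 1); last first.
  by apply/matrixP=> i j; rewrite !mxE !ord1.
by rewrite col_mx_const.
Qed.

Lemma coframe_ones : coframe *m ones R n = col_mx 1%:M 0.
Proof.
rewrite -lsubmx_frame mulmx_lsub coframeK.
by rewrite (@scalar_mx_block _ 1 k.+1) block_mxEh row_mxKl.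
Qed.

Lemma frame_col_mx : frame *m col_mx 1%:M 0 = ones R n.
Proof. by rewrite -coframe_ones mulmxA frameK mul1mx. Qed.

(** [e] is an eigenvector of [A]. *)
Definition upper (A : mat) := dlsubmx (coord A) = 0.

Lemma rowsum_upper (A : mat) s : (forall i, \sum_j A i j = s) -> upper A.
Proof.
move=> As; have A1 : A *m ones R n = s *: ones R n.
  apply/matrixP=> i j; rewrite !mxE mulr1 -[RHS](As i).
  by apply: eq_bigr => l _; rewrite !mxE mulr1.
have colA : lsubmx (coord A) = s *: col_mx 1%:M 0.
  by rewrite /coord -mulmxA -!mulmx_lsub lsubmx_frame A1 -scalemxAr coframe_ones.
apply/matrixP=> i j.
have := congr1 (fun M : 'M_(_, 1) => M (rshift 1 i) j) colA.
by rewrite [in RHS]mxE col_mxEd !mxE mulr0.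
Qed.

Lemma coord_upper A : upper A ->
  coord A = block_mx (parts A).1%:M (ursubmx (coord A)) 0 (parts A).2.
Proof. by move=> A0; rewrite -[LHS]submxK A0 [ulsubmx _]mx11_scalar. Qed.

Lemma partsM A C : upper A -> upper C ->
  upper (A *m C) /\ parts (A *m C) = parts A * parts C.
Proof.
move=> Au Cu; rewrite /upper [in parts (A *m C)]/parts coordM.
rewrite (coord_upper Au) (coord_upper Cu).
rewrite mulmx_block block_mxKdl block_mxKul block_mxKdr.
rewrite !mulmx0 !mul0mx !addr0 ?add0r; split=> //.
by rewrite -scalar_mxM mxE eqxx.
Qed.

Lemma parts1 : parts 1%:M = 1.
Proof. by have := from_partsK 1; rewrite from_parts1. Qed.

Lemma upper1 : upper 1%:M.
Proof. by rewrite /upper coord1 (@scalar_mx_block _ 1 k.+1) block_mxKdl. Qed.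

Lemma parts_prod m (A : 'I_m -> mat) : (forall i, upper (A i)) ->
  upper (mxprod A) /\ parts (mxprod A) = \prod_(i < m) parts (A i).
Proof.
move=> Au; rewrite /mxprod.
apply: (big_rec2 (fun (x : mat) y => upper x /\ parts x = y)).
  by split; [exact: upper1 | exact: parts1].
by move=> i y x _ [xu <-]; have := partsM (Au i) xu.
Qed.

(** The trace of the matrices with diagonal blocks [b], as a form on pairs. *)
Definition ptrace (b : B) : R := b.1 + \tr b.2.

Lemma ptrace_is_linear : linear_for *%R ptrace.
Proof. by move=> a b c; rewrite /ptrace /= linearP /= mulrDr addrACA. Qed.

HB.instance Definition _ :=
  GRing.isLinear.Build R B R *%R ptrace ptrace_is_linear.

Lemma ptrace_mulC (b c : B) : ptrace (b * c) = ptrace (c * b).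
Proof. by rewrite /ptrace /= mulrC; congr (_ + _); exact: mxtrace_mulC. Qed.

Lemma ptrace_nondegenerate (b : B) : (forall c, ptrace (b * c) = 0) -> b = 0.
Proof.
case: b => s M b0; congr pair.
  by have := b0 (1, 0); rewrite /ptrace /= mulr1 mulr0 raddf0 addr0.
apply/matrixP=> i j; have := b0 (0, delta_mx j i).
rewrite /ptrace /= mulr0 add0r => trM; rewrite [RHS]mxE -trM.
rewrite /mxtrace (bigD1 i) //= mxE (bigD1 j) //= !mxE !eqxx mulr1.
rewrite !big1 ?addr0 // => l li; rewrite !mxE.
  by rewrite big1 // => h _; rewrite mxE (negbTE li) andbF mulr0.
by rewrite (negbTE li) mulr0.
Qed.

Lemma trace_parts A : \tr A = ptrace (parts A).
Proof.
transitivity (\tr (coord A)).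
  by rewrite /coord -mulmxA mxtrace_mulC -mulmxA frameK mulmx1.
rewrite -[in LHS](submxK (coord A)) mxtrace_block; congr (_ + _).
by rewrite /mxtrace big_ord1.
Qed.

Lemma char_poly_parts A : upper A ->
  char_poly A = ('X - (parts A).1%:P) * char_poly (parts A).2.
Proof.
move=> Au; rewrite -(char_poly_conj A coframeK) -/(coord A) (coord_upper Au).
rewrite /char_poly /char_poly_mx map_block_mx (@scalar_mx_block _ 1 k.+1).
rewrite opp_block_mx add_block_mx map_mx0 oppr0 addr0 det_ublock.
by rewrite map_scalar_mx -raddfB /= det_scalar1.
Qed.

(** Block diagonal matrices have [e] both as right and as left eigenvector; the
latter because the first row [w] of [coframe] is a multiple of [e^T]. *)
Lemma DSspan_from_parts b : DSspan (from_parts b).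
Proof.
have row1 i : \sum_j from_parts b i j = b.1.
  have := congr1 (fun M : 'cV_n => M i 0) (_ : from_parts b *m ones R n = b.1 *: ones R n).
  rewrite !mxE mulr1 => <-.
    by apply: eq_bigr => j _; rewrite !mxE mulr1.
  rewrite /from_parts -mulmxA coframe_ones -mulmxA mul_block_col.
  rewrite !mulmx0 mul0mx !addr0 mulmx1 -scalemx1 -frame_col_mx scalemxAr scale_col_mx.
  by rewrite scaler0.
pose w : 'rV_n := usubmx coframe.
have w_entry j : w 0 j = n%:R^-1.
  rewrite /w /coframe /block_mx col_mxKu -[j]/(j : 'I_(1 + k.+1)).
  rewrite (_ : n%:R^-1%:M = const_mx n%:R^-1) ?row_mx_const ?mxE //.
  by apply/matrixP=> i l; rewrite !mxE !ord1.
have wA : w *m from_parts b = b.1 *: w.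
  rewrite /from_parts !mulmxA mul_usub_mx coframeK (@scalar_mx_block _ 1 k.+1).
  rewrite /block_mx col_mxKu mul_row_col mul1mx mul0mx addr0 -[in LHS](vsubmxK coframe).
  by rewrite mul_row_col mul0mx addr0 mul_scalar_mx.
have col1 j : \sum_i from_parts b i j = b.1.
  have n0 : n%:R^-1 != 0 :> R by rewrite invr_eq0 pnatr_eq0.
  apply: (mulfI n0); rewrite mulr_sumr [RHS]mulrC -[in RHS](w_entry j).
  have := congr1 (fun M : 'rV_n => M 0 j) wA; rewrite [in X in _ = X -> _]mxE => <-.
  by rewrite mxE; apply: eq_bigr => i _; rewrite w_entry.
exact: sums_DSspan row1 col1.
Qed.

(** Taking the doubly stochastic part deletes the off-diagonal block: what is
deleted is [e] times a row killed by [e], and the decomposition is unique. *)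
Lemma A_DS_parts A : RSspan A -> A_DS A = from_parts (parts A).
Proof.
move=> /RSspan_rowsum [s As]; have Au := rowsum_upper As; apply/esym.
pose v := ursubmx (coord A) *m dsubmx coframe.
have AE : A = from_parts (parts A) + ones R n *m v^T^T.
  rewrite trmxK -frame_col_mx /from_parts -(mulmxA frame) -(mulmxA frame) -mulmxDr.
  rewrite (mul_col_mx 1%:M 0 v) mul1mx mul0mx /v.
  transitivity (frame *m (coord A *m coframe)).
    by rewrite /coord -!mulmxA frameK mulmx1 mulmxA frameK mul1mx.
  congr (_ *m _); rewrite {1}(coord_upper Au) -{1 2}(vsubmxK coframe).
  by rewrite !mul_block_col !mul0mx add_col_mx !addr0 ?add0r.
have v0 : v^T^T *m ones R n = 0.
  by rewrite trmxK -mulmxA mul_dsub_mx coframe_ones col_mxKd mulmx0.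
have vR : Rspace (ones R n *m v^T^T) by exists v^T.
by have [] := A_DS_A_R_unique (ltn0Sn _) AE (DSspan_from_parts _) vR.
Qed.

Lemma DSspan_RSspan A : DSspan A -> @RSspan R n A.
Proof. by move=> [s sDS As]; exists s => // C /sDS []. Qed.

Lemma DSspan_parts A : DSspan A -> from_parts (parts A) = A.
Proof.
move=> ADS; rewrite -A_DS_parts; last exact: DSspan_RSspan.
have R0 : @Rspace R n 0 by exists 0; rewrite trmx0 ?mul0mx ?mulmx0.
have A0 : A = A + 0 by rewrite addr0.
by have [] := A_DS_A_R_unique (ltn0Sn _) A0 ADS R0.
Qed.

End BlockCoordinates.

(** * The two forms of the preservers *)
Lemma mxprodE (R : realType) m k (A : 'I_m -> 'M[R]_k.+1) :
  mxprod A = \prod_(i < m) A i.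
Proof. by []. Qed.

Lemma altsign_mxK (R : realType) n : altsign_mx R n *m altsign_mx R n = 1%:M.
Proof.
rewrite mulmx_diag -diag_const_mx; congr diag_mx.
by apply/rowP=> i; rewrite !mxE -exprD addnn -mul2n exprM sqrrN !expr1n.
Qed.

Lemma altsign_unit (R : realType) n :
  altsign_mx R n \in unitmx /\ invmx (altsign_mx R n) = altsign_mx R n.
Proof.
have [Pu _] := mulmx1_unit (altsign_mxK R n); split=> //.
by rewrite -[LHS]mulmx1 -(altsign_mxK R n) mulKmx.
Qed.

(** In the basis [(1, 1), (-1, 1)], multiplication by [diag(1, -1)] exchanges the
two basis lines, so conjugation by it exchanges the two eigenvalues of a matrix
in the span of the doubly stochastic ones. *)
Lemma altsign_conj (R : realType) (b : R^o * 'M[R]_1) :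
  altsign_mx R 2 *m from_parts b *m altsign_mx R 2 =
  from_parts (b.2 0 0 : R^o, b.1%:M).
Proof.
set P := altsign_mx R 2.
pose swap : 'M[R]_(1 + 1) := block_mx 0 (-1)%:M (-1)%:M 0.
have PE : P = block_mx (1%:M : 'M_1) 0 0 (-1)%:M :> 'M_(1 + 1).
  apply/matrixP=> i j.
  have [i0 ->|i0 ->] := split_ordP i; have [j0 ->|j0 ->] := split_ordP j;
    rewrite !ord1 ?block_mxEul ?block_mxEur ?block_mxEdl ?block_mxEdr /P !mxE /=;
    by rewrite ?eqxx ?mulr1n ?expr0 ?expr1.
have Pframe : P *m frame R 0 = frame R 0 *m swap.
  have cE c : const_mx c = c%:M :> 'M[R]_1.
    by apply/matrixP=> i j; rewrite !mxE !ord1.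
  rewrite PE /frame /swap !cE [LHS](@mulmx_block _ 1 1 1 1 1 1) mulmx_block.
  rewrite !mulmx0 !mul0mx -!scalar_mxM.
  by rewrite !addr0 !add0r !mul1r !mulr1 mulrNN mulr1.
have coframeP : coframe R 0 *m P = swap *m coframe R 0.
  rewrite -[P]mulmx1 -[X in P *m X](frameK R 0) (mulmxA P) Pframe.
  by rewrite !mulmxA coframeK mul1mx.
rewrite /from_parts !mulmxA Pframe -(mulmxA _ (coframe R 0)) coframeP !mulmxA.
congr (_ *m _); rewrite -!mulmxA; congr (_ *m _).
rewrite /swap !mulmx_block !(mulmx0, mul0mx, addr0, add0r) [b.2]mx11_scalar.
by rewrite -!scalar_mxM !mulrN1 !mulN1r !opprK mxE eqxx mulr1n.
Qed.

Section Assembly.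

Variables (R : realType) (k m : nat) (phi : 'I_m -> 'M[R]_k.+2 -> 'M[R]_k.+2).
Hypothesis phi_RS : forall i A, RSspan A -> RSspan (phi i A).
Notation B := (R^o * 'M[R]_k.+1)%type.

Lemma RSspan_upper (A : 'M[R]_k.+2) : RSspan A -> @upper R k A.
Proof. by move=> /RSspan_rowsum [s As]; exact: rowsum_upper As. Qed.

(** Spectral questions about products only involve the doubly stochastic parts. *)
Lemma char_poly_A_DS (A : 'I_m -> 'M[R]_k.+2) : (forall i, RSspan (A i)) ->
  char_poly (mxprod A) = char_poly (mxprod (fun i => A_DS (A i))).
Proof.
move=> AS.
have DS i : RSspan (A_DS (A i)).
  by rewrite A_DS_parts //; exact/DSspan_RSspan/DSspan_from_parts.
have [u p] := @parts_prod R k m A (fun i => RSspan_upper (AS i)).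
have [u' p'] := @parts_prod R k m _ (fun i => RSspan_upper (DS i)).
rewrite (char_poly_parts u) (char_poly_parts u') p p'.
suff -> : \prod_(i < m) parts (A i) = \prod_(i < m) parts (A_DS (A i)) by [].
by apply: eq_bigr => i _; rewrite A_DS_parts // from_partsK.
Qed.

(** The abstract structure theorem, applied with the row stochastic span as domain
and [from_parts] as section of [parts]. *)
Lemma trace_preserver_parts : (2 < m)%N ->
  (forall A : 'I_m -> 'M[R]_k.+2, (forall i, RSspan (A i)) ->
     \tr (mxprod (fun i => phi i (A i))) = \tr (mxprod A)) ->
  exists (alpha : {lrmorphism B -> B}) (u : nat -> B),
    [/\ injective alpha, forall v, exists b, alpha b = v,
        u 0%N = 1 /\ forall l, u l \is a GRing.unit,
        forall i A, RSspan A ->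
          parts (phi i A) = (u i)^-1 * alpha (parts A) * u i.+1 &
        (forall b, ptrace (alpha b) = ptrace b) -> u m = 1].
Proof.
move=> m2 tr_phi.
pose X := {A : 'M[R]_k.+2 | RSspan A}.
pose rho (x : X) := parts (sval x) : B.
pose sigma (b : B) : X :=
  exist _ (from_parts b) (DSspan_RSspan (DSspan_from_parts b)).
have sigmaK : cancel sigma rho by move=> b; exact: from_partsK.
pose f i (x : X) := parts (phi i (sval x)) : B.
have pf : tau_preserving (@ptrace R k) rho f.
  move=> x; have xS i : RSspan (sval (x i)) := svalP (x i).
  have [_ <-] := @parts_prod R k m _ (fun i => RSspan_upper (xS i)).
  have [_ <-] := @parts_prod R k m _ (fun i => RSspan_upper (phi_RS i (xS i))).
  by rewrite /= -!trace_parts; exact: tr_phi.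
have [alpha [u [inj surj u01 fE tauE]]] :=
  tau_preserving_structure (@ptrace_mulC R k) (@ptrace_nondegenerate R k) sigmaK m2 pf.
exists alpha, u; split=> //.
  by move=> i A AS; exact: (fE i (exist _ A AS)).
move=> alpha_ptrace; apply/eqP; rewrite -subr_eq0; apply/eqP/ptrace_nondegenerate => c.
have [b <-] := surj c.
by rewrite ptrace_mulC mulrBr mulr1 raddfB /= tauE alpha_ptrace subrr.
Qed.

End Assembly.

Lemma pair_mx1_mulC (R : comNzRingType) (b c : R^o * 'M[R]_1) : b * c = c * b.
Proof.
case: b c => s M [t N]; congr pair; first exact: mulrC.
by rewrite /= (mx11_scalar M) (mx11_scalar N) -!mulmxE -!scalar_mxM mulrC.
Qed.

Lemma trace_preserver2 (R : realType) m (phi : 'I_m -> 'M[R]_2 -> 'M[R]_2) :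
  (forall i A, RSspan A -> RSspan (phi i A)) -> (2 < m)%N ->
  (forall A : 'I_m -> 'M[R]_2, (forall i, RSspan (A i)) ->
     \tr (mxprod (fun i => phi i (A i))) = \tr (mxprod A)) ->
  exists (P : 'M[R]_2) (Q : 'I_m -> 'M[R]_2),
    [/\ P = 1%:M \/ P = altsign_mx R 2,
        forall i, DSspan (Q i) /\ Q i \in unitmx,
        mxprod Q = 1%:M &
        forall (i : 'I_m) (A : 'M[R]_2), RSspan A ->
          A_DS (phi i A) = P *m A_DS A *m invmx P *m Q i].
Proof.
move=> phi_RS m2 tr_phi.
have [alpha [u [inj _ [u0 uU] phiE um1]]] := trace_preserver_parts phi_RS m2 tr_phi.
have [P [P1 PE tauE]] : exists P, [/\ P = 1%:M \/ P = altsign_mx R 2,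
    forall b, from_parts (alpha b) = P *m from_parts b *m invmx P &
    forall b, ptrace (alpha b) = ptrace b].
  have [alphaE|alphaE] := lrmorphism_pair_swap inj.
    exists 1%:M; split; first by left.
      by move=> b; rewrite alphaE invmx1 mulmx1 mul1mx.
    by move=> b; rewrite alphaE.
  exists (altsign_mx R 2); split; first by right.
    by move=> b; rewrite alphaE (altsign_unit R 2).2 -altsign_conj.
  by move=> b; rewrite alphaE /ptrace /= mxtrace_scalar mulr1n /mxtrace big_ord1 addrC.
pose q i := (u i)^-1 * u i.+1.
have qU i : q i \is a GRing.unit by rewrite unitrMl ?unitrV.
exists P, (fun i : 'I_m => from_parts (q i)); split=> // [i||i A AS].
- by split; [exact: DSspan_from_parts | exact: (from_partsV (qU i)).1].
- have qE j : \prod_(i < j) q i = u j.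
    elim: j => [|j IHj]; first by rewrite big_ord0 u0.
    by rewrite big_ord_recr /= IHj /q mulVKr.
  by rewrite mxprodE -from_parts_prod qE um1 // from_parts1.
- rewrite (A_DS_parts AS) (A_DS_parts (phi_RS i A AS)) phiE // -PE.
  rewrite mulmxE -from_partsM; congr from_parts.
  by rewrite /q mulrA (pair_mx1_mulC (u i)^-1).
Qed.

Lemma trace_preserver3 (R : realType) k m (phi : 'I_m -> 'M[R]_k.+2 -> 'M[R]_k.+2) :
  (0 < k)%N -> (forall i A, RSspan A -> RSspan (phi i A)) -> (2 < m)%N ->
  (forall A : 'I_m -> 'M[R]_k.+2, (forall i, RSspan (A i)) ->
     \tr (mxprod (fun i => phi i (A i))) = \tr (mxprod A)) ->
  exists P : 'I_m.+1 -> 'M[R]_k.+2,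
    [/\ forall l, DSspan (P l) /\ P l \in unitmx,
        P ord_max = P ord0 &
        forall (i : 'I_m) (A : 'M[R]_k.+2), RSspan A ->
          A_DS (phi i A) =
          P (widen_ord (leqnSn m) i) *m A_DS A *m invmx (P (lift ord0 i))].
Proof.
move=> k0 phi_RS m2 tr_phi.
have [alpha [u [_ surj [u0 uU] phiE um1]]] := trace_preserver_parts phi_RS m2 tr_phi.
have [p pU alphaE] := lrmorphism_pair_inner k0 surj.
have {}um1 : u m = 1.
  by apply: um1 => b; rewrite alphaE ptrace_mulC mulrA mulVr // mul1r.
have upU l : (u l)^-1 * p \is a GRing.unit by rewrite unitrMl ?unitrV.
exists (fun l : 'I_m.+1 => from_parts ((u l)^-1 * p)); split=> [l||i A AS].
- by split; [exact: DSspan_from_parts | exact: (from_partsV (upU l)).1].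
- by rewrite /= um1 u0.
- rewrite (from_partsV (upU _)).2 (A_DS_parts AS) (A_DS_parts (phi_RS i A AS)).
  rewrite phiE // alphaE !mulmxE -!from_partsM; congr from_parts.
  by rewrite invrM ?unitrV // invrK !mulrA.
Qed.

Lemma mxprod_telescope (R : realType) m k (P : 'I_m.+1 -> 'M[R]_k.+1)
    (D : 'I_m -> 'M[R]_k.+1) : (forall l, P l \in unitmx) ->
  mxprod (fun i => P (widen_ord (leqnSn m) i) *m D i *m invmx (P (lift ord0 i)))
  = P ord0 *m mxprod D *m invmx (P ord_max).
Proof.
rewrite !mxprodE; elim: m P D => [|m IHm] P D PU.
  rewrite !big_ord0 mulmx1 (_ : ord_max = ord0) ?mulmxV //.
  by apply: val_inj.
rewrite !big_ord_recl -!mulmxE.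
under eq_bigr => i _.
  rewrite (_ : widen_ord _ _ = lift ord0 (widen_ord (leqnSn m) i)); last by apply: val_inj.
  over.
rewrite (IHm (fun l => P (lift ord0 l)) (fun i => D (lift ord0 i))) //.
rewrite (_ : widen_ord _ ord0 = ord0); last by apply: val_inj.
rewrite (_ : lift ord0 ord_max = ord_max); last by apply: val_inj.
by rewrite !mulmxA mulmxKV.
Qed.

Lemma mulmx_DSspan2 (R : realType) (C D : 'M[R]_2) :
  DSspan C -> DSspan D -> C *m D = D *m C.
Proof.
move=> /DSspan_parts <- /DSspan_parts <-; rewrite !mulmxE -!from_partsM.
by rewrite pair_mx1_mulC.
Qed.

Lemma spec_char_poly (R : realType) n (A C : 'M[R]_n) :
  char_poly A = char_poly C -> spec A = spec C.
Proof.
have mapE (M : 'M[R]_n) : char_poly (map_mx (real_complex R) M) =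
    map_poly (real_complex R) (char_poly M) by rewrite map_char_poly.
by move=> eqc; rewrite /spec !mapE eqc.
Qed.

Lemma spec_trace (R : realType) n (A C : 'M[R]_n.+1) :
  spec A = spec C -> \tr A = \tr C.
Proof.
move=> eqc.
have trE (M : 'M[R]_n.+1) :
    (char_poly (map_mx (real_complex R) M))`_n = - real_complex R (\tr M).
  by rewrite (char_poly_trace _ (ltn0Sn n)) trace_map_mx.
have eq_char : char_poly (map_mx (real_complex R) A) =
    char_poly (map_mx (real_complex R) C).
  by rewrite (char_poly_spec A) (char_poly_spec C) eqc.
by apply: (fmorph_inj (real_complex R)); apply: oppr_inj; rewrite -!trE eq_char.
Qed.

(** Conjugation by [P] keeps the span of the 2 x 2 doubly stochastic matrices, which
is commutative; this allows collecting the factors [Q i] at the end. *)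
Lemma char_poly_form2 (R : realType) m (phi : 'I_m -> 'M[R]_2 -> 'M[R]_2)
    (P : 'M[R]_2) (Q A : 'I_m -> 'M[R]_2) :
  (forall i A, RSspan A -> RSspan (phi i A)) ->
  P = 1%:M \/ P = altsign_mx R 2 -> (forall i, DSspan (Q i)) ->
  mxprod Q = 1%:M ->
  (forall (i : 'I_m) (A : 'M[R]_2), RSspan A ->
     A_DS (phi i A) = P *m A_DS A *m invmx P *m Q i) ->
  (forall i, RSspan (A i)) ->
  char_poly (mxprod (fun i => phi i (A i))) = char_poly (mxprod A).
Proof.
move=> phi_RS P1 QDS Q1 phiE AS.
have PU : P \in unitmx.
  by case: P1 => ->; [exact: unitmx1 | exact: (altsign_unit R 2).1].
have DS i : DSspan (P *m A_DS (A i) *m invmx P).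
  rewrite (A_DS_parts (AS i)); case: P1 => ->.
    by rewrite invmx1 mulmx1 mul1mx; exact: DSspan_from_parts.
  by rewrite (altsign_unit R 2).2 altsign_conj; exact: DSspan_from_parts.
rewrite (char_poly_A_DS (fun i => phi_RS i _ (AS i))) (char_poly_A_DS AS).
have -> : mxprod (fun i => A_DS (phi i (A i))) =
          mxprod (fun i => P *m A_DS (A i) *m invmx P) *m mxprod Q.
  rewrite !mxprodE mulmxE -GRing.prodrM_comm; last first.
    by move=> i j _ _; exact: mulmx_DSspan2 (DS i) (QDS j).
  by apply: eq_bigr => i _; exact: phiE.
rewrite Q1 mulmx1 (mxprod_telescope (P := fun=> P)) //.
exact/char_poly_conj/mulmxV.
Qed.

Lemma char_poly_form3 (R : realType) k m (phi : 'I_m -> 'M[R]_k.+2 -> 'M[R]_k.+2)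
    (P : 'I_m.+1 -> 'M[R]_k.+2) (A : 'I_m -> 'M[R]_k.+2) :
  (forall i A, RSspan A -> RSspan (phi i A)) ->
  (forall l, P l \in unitmx) -> P ord_max = P ord0 ->
  (forall (i : 'I_m) (A : 'M[R]_k.+2), RSspan A ->
     A_DS (phi i A) =
     P (widen_ord (leqnSn m) i) *m A_DS A *m invmx (P (lift ord0 i))) ->
  (forall i, RSspan (A i)) ->
  char_poly (mxprod (fun i => phi i (A i))) = char_poly (mxprod A).
Proof.
move=> phi_RS PU P0 phiE AS.
rewrite (char_poly_A_DS (fun i => phi_RS i _ (AS i))) (char_poly_A_DS AS).
have -> : mxprod (fun i => A_DS (phi i (A i))) =
    mxprod (fun i => P (widen_ord (leqnSn m) i) *m A_DS (A i)
                     *m invmx (P (lift ord0 i))).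
  by rewrite !mxprodE; apply: eq_bigr => i _; exact: phiE.
by rewrite mxprod_telescope // P0; exact/char_poly_conj/mulmxV.
Qed.

Theorem theorem4p3 (R : realType) (n m : nat) (hn : (2 <= n)%N) (hm : (3 <= m)%N)
    (phi : 'I_m -> 'M[R]_n -> 'M[R]_n)
    (hphi : forall (i : 'I_m) (A : 'M[R]_n), RSspan A -> RSspan (phi i A)) :
  [<->
    (forall A : 'I_m -> 'M[R]_n, (forall i, RSspan (A i)) ->
       \tr (mxprod (fun i => phi i (A i))) = \tr (mxprod A));
    (forall A : 'I_m -> 'M[R]_n, (forall i, RSspan (A i)) ->
       spec (mxprod (fun i => phi i (A i))) = spec (mxprod A));
    (n = 2%N ->
       exists (P : 'M[R]_n) (Q : 'I_m -> 'M[R]_n),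
         [/\ P = 1%:M \/ P = altsign_mx R n,
             forall i, DSspan (Q i) /\ Q i \in unitmx,
             mxprod Q = 1%:M &
             forall (i : 'I_m) (A : 'M[R]_n), RSspan A ->
               A_DS (phi i A) = P *m A_DS A *m invmx P *m Q i]) /\
    ((3 <= n)%N ->
       exists P : 'I_m.+1 -> 'M[R]_n,
         [/\ forall k, DSspan (P k) /\ P k \in unitmx,
             P ord_max = P ord0 &
             forall (i : 'I_m) (A : 'M[R]_n), RSspan A ->
               A_DS (phi i A) =
               P (widen_ord (leqnSn m) i) *m A_DS A *m invmx (P (lift ord0 i))])].
Proof.
have [k nE] : exists k, n = k.+2.
  by case: n hn {phi hphi} => [|[|k]] // _; exists k.
(* Writing the size as [k.+2] exposes the block sizes 1 and [k.+1]. *)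
subst n => {hn}.
set tr_pres := (X in [<-> X; _; _]); set spec_pres := (X in [<-> _; X; _]).
set form := (X in [<-> _; _; X]).
have to_form : tr_pres -> form.
  rewrite /tr_pres /form {tr_pres spec_pres form}.
  case: k phi hphi => [|k] phi hphi tr_phi; split=> // _.
    exact: trace_preserver2.
  exact: trace_preserver3.
have to_spec : form -> spec_pres.
  rewrite /spec_pres /form {tr_pres spec_pres form to_form}.
  case: k phi hphi => [|k] phi hphi [form2 form3] A AS; apply: spec_char_poly.
    have [P [Q [P1 QDS Q1 phiE]]] := form2 erefl.
    exact: char_poly_form2 P1 (fun i => (QDS i).1) Q1 phiE AS.
  have [P [PDS P0 phiE]] := form3 isT.
  exact: char_poly_form3 (fun l => (PDS l).2) P0 phiE AS.
have to_tr : spec_pres -> tr_pres.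
  by rewrite /tr_pres => sp A AS; exact: spec_trace (sp A AS).
tfae.
- by move/to_form/to_spec.
- by move/to_tr/to_form.
- by move/to_spec/to_tr.
Qed.
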